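(* There exists a polynomial-time algorithm which receives as input an instance of 23SAT and outputs an instance of 23SAT that has no bad pairs and is equivalent to the input instance (i.e. the output instance is satisfiable if and only if the input instance is satisfiable).
   Context: Let $\mathcal{X}=\{x_1,\dots,x_n\}$ be a set of Boolean variables; the literals are $x_i$ and their negations $\overline{x_i}$ (with $\overline{\overline{l}}=l$). A clause is a set of literals (interpreted as their disjunction) containing, for each variable, at most one of $x_i,\overline{x_i}$. A truth assignment satisfies a clause if it makes at least one literal of the clause true. For an instance $(\mathcal{X},\mathcal{C})$, a literal is major if it belongs to at least two clauses of $\mathcal{C}$, and minor if it belongs to exactly one clause. An instance of 23SAT is a pair $(\mathcal{X},\mathcal{C})$ where every clause of $\mathcal{C}$ contains $2$ or $3$ literals and every clause contains at most one major literal; the question is whether some truth assignment satisfies all clauses. A bad pair in an instance $(\mathcal{X},\mathcal{C})$ is a set of two clauses $\{c_1,c_2\}\subseteq\mathcal{C}$ for which there exist two literals $l_1,l_2$ with $\{l_1,l_2\}\subseteq c_1$ and $\{\overline{l_1},\overline{l_2}\}\subseteq c_2$. *)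

(* Defs.v *)
From mathcomp Require Import all_boot all_order all_algebra.

Set Implicit Arguments.
Unset Strict Implicit.
Unset Printing Implicit Defensive.

(** * Instances of 23SAT *)

(* (x, true) is the literal x and (x, false) is its negation. *)
Definition literal (n : nat) : finType := ('I_n * bool)%type.

Definition neg n (l : literal n) : literal n := (l.1, ~~ l.2).

Record instance := Instance {
  nvars : nat;
  clauses : {set {set literal nvars}}
}.

Definition is_clause n (c : {set literal n}) : bool :=
  [forall l : literal n, ~~ ((l \in c) && (neg l \in c))].

Definition occurrences n (C : {set {set literal n}}) (l : literal n) : nat :=
  #|[set c in C | l \in c]|.

Definition major n (C : {set {set literal n}}) (l : literal n) : bool :=
  1 < occurrences C l.

Definition is_23SAT (I : instance) : Prop :=
  forall c, c \in clauses I ->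
    [/\ is_clause c,
        (#|c| == 2) || (#|c| == 3)
      & #|[set l in c | major (clauses I) l]| <= 1].

Definition satisfies_clause n (v : 'I_n -> bool) (c : {set literal n}) : Prop :=
  exists2 l : literal n, l \in c & v l.1 = l.2.

Definition satisfiable (I : instance) : Prop :=
  exists v : 'I_(nvars I) -> bool,
    forall c, c \in clauses I -> satisfies_clause v c.

Definition bad_pair (I : instance) (B : {set {set literal (nvars I)}}) : Prop :=
  B \subset clauses I /\
  exists c1 c2 : {set literal (nvars I)},
    [/\ c1 != c2,
        B = [set c1; c2]
      & exists l1 l2 : literal (nvars I),
          [/\ l1 != l2,
              [set l1; l2] \subset c1
            & [set neg l1; neg l2] \subset c2]].

Arguments bad_pair I B : clear implicits.

(** * Polynomial time

    Algorithms are programs of Jones's language WHILE, whose data are binary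
    trees.  Every value produced while evaluating an expression is charged its
    full size (not one unit), so that running time bounds memory and output
    size; up to a polynomial, this is the running time of a Turing machine. *)

Inductive tree := Leaf | Node of tree & tree.

Fixpoint tree_size (t : tree) : nat :=
  if t is Node t1 t2 then (tree_size t1 + tree_size t2).+1 else 1.

Fixpoint tree_eqb (t u : tree) : bool :=
  match t, u with
  | Leaf, Leaf => true
  | Node t1 t2, Node u1 u2 => tree_eqb t1 u1 && tree_eqb t2 u2
  | _, _ => false
  end.

Definition tree_of_bool (b : bool) : tree := if b then Node Leaf Leaf else Leaf.

Inductive expr :=
  | Var of nat
  | Const of tree
  | Cons of expr & expr
  | Hd of expr
  | Tl of expr
  | Eq of expr & expr.

Inductive cmd :=
  | Skip
  | Assign of nat & expr
  | Seq of cmd & cmd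
  | If of expr & cmd & cmd
  | While of expr & cmd.

Definition store := nat -> tree.

Definition update (s : store) (x : nat) (t : tree) : store :=
  fun y => if y == x then t else s y.

Fixpoint eval (s : store) (e : expr) : tree :=
  match e with
  | Var x => s x
  | Const t => t
  | Cons e1 e2 => Node (eval s e1) (eval s e2)
  | Hd e1 => if eval s e1 is Node t _ then t else Leaf
  | Tl e1 => if eval s e1 is Node _ t then t else Leaf
  | Eq e1 e2 => tree_of_bool (tree_eqb (eval s e1) (eval s e2))
  end.

Fixpoint eval_cost (s : store) (e : expr) : nat :=
  tree_size (eval s e) +
  match e with
  | Var _ | Const _ => 0
  | Hd e1 | Tl e1 => eval_cost s e1
  | Cons e1 e2 | Eq e1 e2 => eval_cost s e1 + eval_cost s e2
  end.

(* exec c s s' k: started in store s, the command c halts in store s' after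
   time k.  Leaf is false in tests, every other tree is true. *)
Inductive exec : cmd -> store -> store -> nat -> Prop :=
  | ExecSkip s :
      exec Skip s s 1
  | ExecAssign s x e :
      exec (Assign x e) s (update s x (eval s e)) (eval_cost s e).+1
  | ExecSeq c1 c2 s s1 s2 k1 k2 :
      exec c1 s s1 k1 -> exec c2 s1 s2 k2 ->
      exec (Seq c1 c2) s s2 (k1 + k2).+1
  | ExecIfTrue e c1 c2 s s1 k :
      eval s e <> Leaf -> exec c1 s s1 k ->
      exec (If e c1 c2) s s1 (eval_cost s e + k).+1
  | ExecIfFalse e c1 c2 s s1 k :
      eval s e = Leaf -> exec c2 s s1 k ->
      exec (If e c1 c2) s s1 (eval_cost s e + k).+1
  | ExecWhileTrue e c s s1 s2 k1 k2 :
      eval s e <> Leaf -> exec c s s1 k1 -> exec (While e c) s1 s2 k2 ->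
      exec (While e c) s s2 (eval_cost s e + k1 + k2).+1
  | ExecWhileFalse e c s :
      eval s e = Leaf ->
      exec (While e c) s s (eval_cost s e).+1.

(* Variable 0 holds the input at the start and the output at the end; all other
   variables are initially Leaf. *)
Definition run (p : cmd) (t u : tree) (k : nat) : Prop :=
  exists s : store, exec p (update (fun _ => Leaf) 0 t) s k /\ s 0 = u.

(** * Encoding of instances as trees *)

Definition tree_of_seq (T : Type) (enc : T -> tree) (s : seq T) : tree :=
  foldr (fun x t => Node (enc x) t) Leaf s.

(* Binary notation, least significant bit first. *)
Fixpoint bits_of_pos (p : BinNums.positive) : seq bool :=
  match p with
  | BinNums.xH => [:: true]
  | BinNums.xO p' => false :: bits_of_pos p'
  | BinNums.xI p' => true :: bits_of_pos p'
  end.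

Definition bits_of_nat (n : nat) : seq bool :=
  if bin_of_nat n is BinNums.Npos p then bits_of_pos p else [::].

Definition tree_of_nat (n : nat) : tree :=
  tree_of_seq tree_of_bool (bits_of_nat n).

Definition tree_of_literal n (l : literal n) : tree :=
  Node (tree_of_bool l.2) (tree_of_nat l.1).

Definition tree_of_lists n (s : seq (seq (literal n))) : tree :=
  Node (tree_of_seq tree_of_nat (iota 0 n))
       (tree_of_seq (tree_of_seq (@tree_of_literal n)) s).

(* Sets are presented as lists without repetitions, in an arbitrary order, so
   an instance has several encodings. *)
Definition encodes (t : tree) (I : instance) : Prop :=
  exists s : seq (seq (literal (nvars I))),
    [/\ all uniq s,
        uniq [seq [set:: c] | c <- s],
        clauses I = [set:: [seq [set:: c] | c <- s]]
      & t = tree_of_lists s].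

(* Main.v *)
(* Detecting bad pairs is unnecessary: every clause {l_1, ..., l_k} is replaced
   by {y_1, ..., y_k} together with the links {~y_i, l_i}, where each occurrence
   of a literal gets its own fresh variable y_i.  Every literal on a fresh
   variable is then minor, so each new clause has at most one major literal.
   Clauses on fresh variables are positive, so a bad pair contains a link; its
   other clause contains the negations of both literals of the link, but y_i
   occurs only in {y_1, ..., y_k}, where no old variable occurs. *)

From mathcomp Require Import all_boot all_order all_algebra.
From mathcomp Require Import zify.
From Stdlib Require Import FunctionalExtensionality.
Require Import Defs.

Set Implicit Arguments.
Unset Strict Implicit.
Unset Printing Implicit Defensive.

(** * Binary numerals and sizes of encodings *)

Local Notation bits_tree := (tree_of_seq tree_of_bool).

(** The default branch treats at once a leading 0 and the empty numeral of 0, thanks to [behead]. *)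
Fixpoint inc_bits (b : seq bool) : seq bool :=
  match b with
  | true :: b' => false :: inc_bits b'
  | _ => true :: behead b
  end.

Lemma bits_of_natS j : bits_of_nat j.+1 = inc_bits (bits_of_nat j).
Proof.
rewrite /bits_of_nat.
have -> : bin_of_nat j.+1 = BinNat.N.succ (bin_of_nat j).
  apply: (can_inj nat_of_binK); rewrite bin_of_natK -[in LHS](bin_of_natK j).
  by case: (bin_of_nat j) => //= p; rewrite nat_of_succ_pos.
by case: (bin_of_nat j) => //=; elim=> //= p ->.
Qed.

(** A linear bound, though crude, is enough: instances list their variables one by one, so variable
    numbers are bounded by the size of the encoding. *)
Lemma size_bits_of_nat j : size (bits_of_nat j) <= j.
Proof.
have size_inc b : size (inc_bits b) <= (size b).+1.
  by elim: b => [|[] b IHb] //=; lia.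
elim: j => // j IHj; rewrite bits_of_natS.
exact: leq_trans (size_inc _) _.
Qed.

Lemma tree_size_gt0 t : 0 < tree_size t.
Proof. by case: t. Qed.

Lemma tree_size_seq_le T (enc : T -> tree) (s : seq T) b :
  (forall x, tree_size (enc x) < b) ->
  tree_size (tree_of_seq enc s) <= (size s * b).+1.
Proof. by move=> sz_b; elim: s => //= x s IHs; have := sz_b x; lia. Qed.

(** The successor on the left accounts for the final [Leaf], counted twice on the right. *)
Lemma tree_size_catrev T (enc : T -> tree) (s r : seq T) :
  (tree_size (tree_of_seq enc (catrev s r))).+1
    = tree_size (tree_of_seq enc s) + tree_size (tree_of_seq enc r).
Proof. by elim: s r => [|x s IHs] r //=; rewrite IHs /=; lia. Qed.

Lemma tree_size_nat j : tree_size (tree_of_nat j) <= (4 * j).+1.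
Proof.
have sz b : tree_size (tree_of_bool b) < 4 by case: b.
apply: leq_trans (tree_size_seq_le _ sz) _.
have := size_bits_of_nat j; lia.
Qed.

(** * Executions with a bound on their time *)

(* A store is given by the list of its registers; the others hold Leaf. *)
Definition runs (c : cmd) (ts ts' : seq tree) (K : nat) : Prop :=
  exists2 k, exec c (nth Leaf ts) (nth Leaf ts') k & k <= K.

Lemma runs_assign ts x e :
  runs (Assign x e) ts (set_nth Leaf ts x (eval (nth Leaf ts) e))
       (eval_cost (nth Leaf ts) e).+1.
Proof.
exists (eval_cost (nth Leaf ts) e).+1 => //.
have -> : nth Leaf (set_nth Leaf ts x (eval (nth Leaf ts) e))
        = update (nth Leaf ts) x (eval (nth Leaf ts) e).
  by apply: functional_extensionality => y; rewrite nth_set_nth.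
exact: ExecAssign.
Qed.

Lemma runs_seq c1 c2 ts ts1 ts2 K1 K2 :
  runs c1 ts ts1 K1 -> runs c2 ts1 ts2 K2 ->
  runs (Seq c1 c2) ts ts2 (K1 + K2).+1.
Proof.
move=> [k1 e1 le1] [k2 e2 le2]; exists (k1 + k2).+1; last by lia.
exact: ExecSeq e1 e2.
Qed.

Lemma runs_le c ts ts' K K' : runs c ts ts' K -> K <= K' -> runs c ts ts' K'.
Proof. by move=> [k ek le_k] leK; exists k => //; apply: leq_trans leK. Qed.

Lemma runs_while_false e c ts :
  eval (nth Leaf ts) e = Leaf ->
  runs (While e c) ts ts (eval_cost (nth Leaf ts) e).+1.
Proof. by move=> e0; eexists; [exact: ExecWhileFalse|]. Qed.

Lemma runs_while_true e c ts ts1 ts2 K1 K2 :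
  eval (nth Leaf ts) e <> Leaf -> runs c ts ts1 K1 ->
  runs (While e c) ts1 ts2 K2 ->
  runs (While e c) ts ts2 (eval_cost (nth Leaf ts) e + K1 + K2).+1.
Proof.
move=> e1 [k1 ek1 le1] [k2 ek2 le2].
by eexists; [exact: ExecWhileTrue e1 ek1 ek2|lia].
Qed.

Declare Scope cmd_scope.
Local Notation "x ::= e" := (Assign x e) (at level 60) : cmd_scope.
Local Notation "c1 ;; c2" := (Seq c1 c2)
  (at level 65, right associativity) : cmd_scope.
Local Open Scope cmd_scope.
Local Coercion Var : nat >-> expr.

(** * Binary increment as a program *)

(* Register 1 holds the number to increment and register 6 is Leaf at the start
   and at the end: it keeps the zeros that replace the leading ones. *)
Definition increment : cmd :=
  While (Hd 1)
    (6 ::= Cons (Const Leaf) 6 ;;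
     1 ::= Tl 1) ;;
  1 ::= Cons (Const (tree_of_bool true)) (Tl 1) ;;
  While 6
    (1 ::= Cons (Hd 6) 1 ;;
     6 ::= Tl 6).

(** Models the first loop of [increment]: the components of the result are the final contents of
    registers 1 and 6. *)
Fixpoint carry (b r : seq bool) : seq bool * seq bool :=
  if b is true :: b' then carry b' (false :: r) else (b, r).

Lemma carryP b r :
  catrev (carry b r).2 (true :: behead (carry b r).1) = catrev r (inc_bits b).
Proof. by elim: b r => [|[] b IHb] r //=; rewrite IHb. Qed.

Lemma size_carry b r : size (carry b r).2 <= size b + size r.
Proof. by elim: b r => [|[] b IHb] r //=; have := IHb (false :: r) => /=; lia. Qed.

(** Each step moves a bit from one list to the other and shrinks it from 1 to 0. This bounds the
    registers with which the second loop of [increment] starts. *)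
Lemma tree_size_carry b r :
  tree_size (bits_tree (carry b r).1) + tree_size (bits_tree (carry b r).2)
    <= tree_size (bits_tree b) + tree_size (bits_tree r).
Proof. by elim: b r => [|[] b IHb] r //=; have := IHb (false :: r) => /=; lia. Qed.

(** [Hd 1] is [Leaf] on a leading 0 as well as on the empty list, so the loop stops where [carry]
    does. The joint size of registers 1 and 6 never grows, so a single [B] bounds the cost of every
    round. *)
Lemma runs_carry x0 x2 x3 x4 x5 b r B :
  tree_size (bits_tree b) + tree_size (bits_tree r) <= B ->
  runs (While (Hd 1) (6 ::= Cons (Const Leaf) 6 ;; 1 ::= Tl 1))
    [:: x0; bits_tree b; x2; x3; x4; x5; bits_tree r]
    [:: x0; bits_tree (carry b r).1; x2; x3; x4; x5; bits_tree (carry b r).2]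
    ((size b).+1 * (10 * B)).
Proof.
have pos := tree_size_gt0.
elim: b r => [|[] b IHb] r /= leB.
- by apply: runs_le; [exact: runs_while_false|] => /=; lia.
- apply: runs_le.
    apply: runs_while_true => //=.
      by apply: runs_seq; [exact: runs_assign|exact: runs_assign].
    by apply: (IHb (false :: r)) => /=; lia.
  by rewrite /=; have := pos (bits_tree r); lia.
- by apply: runs_le; [exact: runs_while_false|] => /=; have := pos (bits_tree r); lia.
Qed.

Lemma runs_uncarry x0 x2 x3 x4 x5 b r B :
  tree_size (bits_tree b) + tree_size (bits_tree r) <= B ->
  runs (While 6 (1 ::= Cons (Hd 6) 1 ;; 6 ::= Tl 6))
    [:: x0; bits_tree b; x2; x3; x4; x5; bits_tree r]
    [:: x0; bits_tree (catrev r b); x2; x3; x4; x5; Leaf]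
    ((size r).+1 * (20 * B)).
Proof.
have pos := tree_size_gt0.
elim: r b => [|a r IHr] b /= leB.
- by apply: runs_le; [exact: runs_while_false|] => /=; lia.
- apply: runs_le.
    apply: runs_while_true => //=.
      by apply: runs_seq; [exact: runs_assign|exact: runs_assign].
    by apply: (IHr (a :: b)) => /=; lia.
  by rewrite /=; have := pos (bits_tree r); have := pos (bits_tree b); lia.
Qed.

Lemma runs_increment x0 x2 x3 x4 x5 j :
  runs increment
    [:: x0; tree_of_nat j; x2; x3; x4; x5; Leaf]
    [:: x0; tree_of_nat j.+1; x2; x3; x4; x5; Leaf]
    (400 * j.+1 ^ 2).
Proof.
have := runs_carry x0 x2 x3 x4 x5 (b := bits_of_nat j) (r := [::]) (leqnn _).
have := carryP (bits_of_nat j) [::]; have := size_carry (bits_of_nat j) [::].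
have := tree_size_carry (bits_of_nat j) [::].
case: (carry _ _) => b r /= sz_br size_r inc_j run1.
have sz_j := tree_size_nat j; rewrite /tree_of_nat in sz_j.
have size_j := size_bits_of_nat j.
have sz_b : tree_size (bits_tree (behead b)) <= tree_size (bits_tree b).
  by case: (b) => //= *; lia.
rewrite /tree_of_nat (bits_of_natS j) -inc_j.
apply: runs_le.
  apply: runs_seq; first exact: run1.
  apply: runs_seq; first exact: runs_assign.
  (* When all bits were ones, register 1 is [Leaf]; [Tl] sends it to [Leaf], in agreement with
     [behead [::]]. *)
  have -> : set_nth Leaf [:: x0; bits_tree b; x2; x3; x4; x5; bits_tree r] 1
      (eval (nth Leaf [:: x0; bits_tree b; x2; x3; x4; x5; bits_tree r])
         (Cons (Const (tree_of_bool true)) (Tl 1)))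
    = [:: x0; bits_tree (true :: behead b); x2; x3; x4; x5; bits_tree r].
    by case: (b).
  (* Registers 1 and 6 had joint size at most [4 * j + 2], and the new bit 1 adds at most 4. *)
  by apply: (@runs_uncarry _ _ _ _ _ _ _ (4 * j + 7)) => /=; lia.
rewrite /=.
have -> : (if bits_tree b is Node _ t2 then t2 else Leaf) = bits_tree (behead b).
  by case: (b).
have h1 := leq_mul (_ : (size (bits_of_nat j)).+1 <= j.+1)
  (_ : 10 * (tree_size (bits_tree (bits_of_nat j)) + 1) <= 10 * (4 * j + 2)).
have h2 := leq_mul (_ : (size r).+1 <= j.+1) (leqnn (20 * (4 * j + 7))).
have {}h1 := h1 ltac:(lia) ltac:(lia); have {}h2 := h2 ltac:(lia).
nia.
Qed.

(** * The splitting program and its loops over variables *)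

(* Registers: 0 = clauses still to be read; 1 = next variable number j; 2 = list
   j-1, ..., 0 of the variables in use; 3 = clauses already produced; 4 = clause
   on fresh variables under construction; 5 = rest of the current list. *)
Definition fresh : cmd := 2 ::= Cons 1 2 ;; increment.

(** The input list of variables acts as a unary counter: the numerals are built anew, and register 1
    ends up holding their number in binary. *)
Definition number_variables : cmd := While 5 (fresh ;; 5 ::= Tl 5).

Definition split_literals : cmd :=
  While 5
    (3 ::= Cons (Cons (Cons (Const (tree_of_bool false)) 1)
                      (Cons (Hd 5) (Const Leaf))) 3 ;;
     4 ::= Cons (Cons (Const (tree_of_bool true)) 1) 4 ;;
     fresh ;;
     5 ::= Tl 5).

Definition split_clauses : cmd :=
  While 0
    (5 ::= Hd 0 ;;
     0 ::= Tl 0 ;;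
     split_literals ;;
     3 ::= Cons 4 3 ;;
     4 ::= Const Leaf).

(** Register 2 lists the variables in descending order, while an encoding lists them as
    [iota 0 n]. *)
Definition reverse_variables : cmd :=
  While 2 (6 ::= Cons (Hd 2) 6 ;; 2 ::= Tl 2).

(* The last [fresh] declares a dummy variable: the output has at least one
   variable, so that [inord] applies to its variables. *)
Definition split_instance : cmd :=
  5 ::= Hd 0 ;;
  0 ::= Tl 0 ;;
  number_variables ;;
  split_clauses ;;
  fresh ;;
  reverse_variables ;;
  0 ::= Cons 6 3.

Definition down_to j : tree := tree_of_seq tree_of_nat (rev (iota 0 j)).

Lemma down_toS j : down_to j.+1 = Node (tree_of_nat j) (down_to j).
Proof. by rewrite /down_to -addn1 iotaD rev_cat. Qed.

Lemma tree_size_down_to j : tree_size (down_to j) <= 4 * j.+1 ^ 2.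
Proof.
elim: j => // j IHj; rewrite down_toS /=; have := tree_size_nat j; nia.
Qed.

Lemma runs_fresh x0 x3 x4 x5 j B :
  4 * j.+1 ^ 2 <= B ->
  runs fresh
    [:: x0; tree_of_nat j; down_to j; x3; x4; x5; Leaf]
    [:: x0; tree_of_nat j.+1; down_to j.+1; x3; x4; x5; Leaf]
    (120 * B).
Proof.
move=> leB; have sz_j := tree_size_nat j; have sz_L := tree_size_down_to j.
apply: runs_le.
  apply: runs_seq; first exact: runs_assign.
  by rewrite /= -down_toS; exact: runs_increment.
by rewrite /=; nia.
Qed.

Lemma runs_number_variables T (enc : T -> tree) (s : seq T) x0 x3 x4 j B :
  4 * (j + size s).+1 ^ 2 <= B -> tree_size (tree_of_seq enc s) <= B ->
  runs number_variables
    [:: x0; tree_of_nat j; down_to j; x3; x4; tree_of_seq enc s; Leaf]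
    [:: x0; tree_of_nat (j + size s); down_to (j + size s); x3; x4; Leaf; Leaf]
    ((size s).+1 * (130 * B)).
Proof.
elim: s j => [|x s IHs] j /= leN leB.
  by rewrite addn0; apply: runs_le; [exact: runs_while_false|] => /=; lia.
apply: runs_le.
  apply: runs_while_true => //.
    apply: runs_seq; first by apply: (@runs_fresh _ _ _ _ _ B); nia.
    exact: runs_assign.
  rewrite addnS -addSn; apply: IHs; first by rewrite addSn -addnS.
  by lia.
by rewrite /=; have := tree_size_gt0 (enc x); nia.
Qed.

Lemma runs_reverse_variables T (enc : T -> tree) (s r : seq T) x0 x1 x3 x4 x5 B :
  tree_size (tree_of_seq enc s) + tree_size (tree_of_seq enc r) <= B ->
  runs reverse_variables
    [:: x0; x1; tree_of_seq enc s; x3; x4; x5; tree_of_seq enc r]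
    [:: x0; x1; Leaf; x3; x4; x5; tree_of_seq enc (catrev s r)]
    ((size s).+1 * (20 * B)).
Proof.
have pos := tree_size_gt0.
elim: s r => [|x s IHs] r /= leB.
  by apply: runs_le; [exact: runs_while_false|] => /=; lia.
apply: runs_le.
  apply: runs_while_true => //.
    by apply: runs_seq; exact: runs_assign.
  by apply: (IHs (x :: r)) => /=; lia.
by rewrite /=; have := pos (tree_of_seq enc r); have := pos (tree_of_seq enc s); nia.
Qed.

Lemma size_tree_of_seq T (enc : T -> tree) (s : seq T) :
  (size s).*2 < tree_size (tree_of_seq enc s).
Proof. by elim: s => //= x s IHs; have := tree_size_gt0 (enc x); lia. Qed.

Arguments tree_of_literal : simpl never.

Lemma tree_size_literalE N (l : literal N) :
  tree_size (tree_of_literal l)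
    = (tree_size (tree_of_bool l.2) + tree_size (tree_of_nat l.1)).+1.
Proof. by []. Qed.

Definition literal_bound N := 4 * N + 6.

Lemma tree_size_literal N (l : literal N) :
  tree_size (tree_of_literal l) < literal_bound N.
Proof.
rewrite tree_size_literalE /literal_bound.
have := tree_size_nat l.1; have := ltn_ord l.1.
by case: (l.2) => /=; lia.
Qed.

(** * Running time and output size of the splitting loops *)

Section Splitting.

Variables (n N : nat) (le_nN : n <= N).

(** The number of the variable is kept, so the encoding is unchanged and the program can copy the
    tree of an input literal as it stands. *)
Definition widen_literal (l : literal n) : literal N := (widen_ord le_nN l.1, l.2).

(* A pair [(y, l)] is an occurrence of the literal [l] in the input, together
   with the fresh variable [y] standing for it. *)
Implicit Types (p : 'I_N * literal n) (c : seq ('I_N * literal n)).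
Implicit Types (S : seq (seq ('I_N * literal n))).

Definition link_clause p : seq (literal N) := [:: (p.1, false); widen_literal p.2].

Definition fresh_clause c : seq (literal N) := [seq (p.1, true) | p <- c].

(** Follows the order in which the program pushes onto registers 3 and 4, whence the reversals. *)
Definition split_list S (o : seq (seq (literal N))) :=
  foldl (fun o c => catrev (fresh_clause c) [::] :: catrev (map link_clause c) o)
    o S.

Local Notation clause_tree := (tree_of_seq (@tree_of_literal N)).
Local Notation clauses_tree := (tree_of_seq clause_tree).

(** The hypotheses reserve in advance the growth of registers 3 and 4. An occurrence takes one
    [literal_bound N] for its fresh literal and three for its link: two for the literals, one for
    the nodes around them. *)
Lemma runs_split_literals c j o d x0 B :
  [seq val p.1 | p <- c] = iota j (size c) ->
  4 * (j + size c).+1 ^ 2 <= B ->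
  tree_size (tree_of_seq (@tree_of_literal n) (map snd c)) <= B ->
  tree_size (clauses_tree o) + size c * (3 * literal_bound N) <= B ->
  tree_size (clause_tree d) + size c * literal_bound N <= B ->
  runs split_literals
    [:: x0; tree_of_nat j; down_to j; clauses_tree o; clause_tree d;
        tree_of_seq (@tree_of_literal n) (map snd c); Leaf]
    [:: x0; tree_of_nat (j + size c); down_to (j + size c);
        clauses_tree (catrev (map link_clause c) o);
        clause_tree (catrev (fresh_clause c) d); Leaf; Leaf]
    ((size c).+1 * (200 * B)).
Proof.
elim: c j o d => [|[y l] c IHc] j o d.
  move=> _ leN leB _ _; rewrite addn0.
  by apply: runs_le; [exact: runs_while_false|] => /=; nia.
move=> /= [y_j ys] leN leB leo led.
have szF := tree_size_literal (y, false); have szT := tree_size_literal (y, true).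
have sz_l := tree_size_literal (widen_literal l).
have ge0 := leq0n (size c * literal_bound N).
rewrite !tree_size_literalE /= in leB szF szT sz_l; subst j.
have pos := tree_size_gt0.
apply: runs_le.
  apply: runs_while_true => //.
    apply: runs_seq; first exact: runs_assign.
    apply: runs_seq; first exact: runs_assign.
    apply: runs_seq; first by apply: (@runs_fresh _ _ _ _ _ B); nia.
    exact: runs_assign.
  rewrite addnS -addSn.
  apply: (IHc y.+1 (link_clause (y, l) :: o) ((y, true) :: d)) => //=.
  - by rewrite addSn -addnS.
  - by lia.
  - by rewrite ?tree_size_literalE /=; lia.
  - by rewrite ?tree_size_literalE /=; lia.
have := pos (tree_of_seq (@tree_of_literal n) (map snd c)).
have := pos (clauses_tree o); have := pos (clause_tree d).
by rewrite /= ?tree_size_literalE /=; lia.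
Qed.

Lemma tree_size_links c o :
  tree_size (clauses_tree (catrev (map link_clause c) o))
    <= tree_size (clauses_tree o) + size c * (3 * literal_bound N).
Proof.
elim: c o => [|p c IHc] o /=; first by lia.
apply: leq_trans (IHc _) _; rewrite /=.
have := tree_size_literal (p.1, false); have := tree_size_literal (widen_literal p.2).
by rewrite !tree_size_literalE /=; lia.
Qed.

Lemma tree_size_fresh_clause c d :
  tree_size (clause_tree (catrev (fresh_clause c) d))
    <= tree_size (clause_tree d) + size c * literal_bound N.
Proof.
elim: c d => [|p c IHc] d /=; first by lia.
apply: leq_trans (IHc _) _; rewrite /=.
by have := tree_size_literal (p.1, true); rewrite !tree_size_literalE /=; lia.
Qed.

Lemma tree_size_split_list S o :
  tree_size (clauses_tree (split_list S o))
    <= tree_size (clauses_tree o) + size (flatten S) * (4 * literal_bound N)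
       + 2 * size S.
Proof.
elim: S o => [|c S IHS] o /=; first by lia.
apply: leq_trans (IHS _) _; rewrite size_cat.
have := tree_size_fresh_clause c [::]; have := tree_size_links c o.
by rewrite /=; nia.
Qed.

(** The inner loops make [m] productive rounds over all clauses together, and each clause adds a
    constant number of steps; this gives the factor [m + size S] instead of a product. *)
Lemma runs_split_clauses S j o B :
  let m := size (flatten S) in
  [seq val p.1 | p <- flatten S] = iota j m ->
  4 * (j + m).+1 ^ 2 <= B ->
  tree_size (tree_of_seq (tree_of_seq (@tree_of_literal n)) (map (map snd) S)) <= B ->
  tree_size (clauses_tree o) + m * (4 * literal_bound N) + 2 * size S < B ->
  runs split_clauses
    [:: tree_of_seq (tree_of_seq (@tree_of_literal n)) (map (map snd) S);
        tree_of_nat j; down_to j; clauses_tree o; Leaf; Leaf; Leaf]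
    [:: Leaf; tree_of_nat (j + m); down_to (j + m); clauses_tree (split_list S o);
        Leaf; Leaf; Leaf]
    ((m + size S).+1 * (300 * B)).
Proof.
elim: S j o => [|c S IHS] j o.
  move=> /= _ leN leB leo; rewrite addn0.
  by apply: runs_le; [exact: runs_while_false|] => /=; nia.
rewrite /= size_cat iotaD map_cat => /eqP.
rewrite eqseq_cat ?size_map ?size_iota // => /andP[/eqP c_j /eqP S_j] leN leB leo.
have sz_d := tree_size_fresh_clause c [::].
have sz_o := tree_size_links c o.
have sz_do : tree_size (clauses_tree (catrev (fresh_clause c) [::]
                                      :: catrev (map link_clause c) o))
    + size (flatten S) * (4 * literal_bound N) + 2 * size S < B.
  by move: sz_d sz_o leo => /= *; nia.
apply: runs_le.
  apply: runs_while_true => //.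
    apply: runs_seq; first exact: runs_assign.
    apply: runs_seq; first exact: runs_assign.
    apply: runs_seq.
      apply: (@runs_split_literals c j o [::] _ B c_j) => /=; nia.
    apply: runs_seq; first exact: runs_assign.
    exact: runs_assign.
  rewrite addnA.
  apply: (IHS _ (catrev (fresh_clause c) [::] :: catrev (map link_clause c) o)) => //=.
  - by rewrite -addnA.
  - by lia.
have := tree_size_gt0
  (tree_of_seq (tree_of_seq (@tree_of_literal n)) (map (map snd) S)).
by rewrite /= in sz_do sz_d *; lia.
Qed.

End Splitting.

(** * Correctness of the reduction *)

Section Reduction.

Variables (n N : nat) (le_nN : n <= N) (S : seq (seq ('I_N * literal n))).

Implicit Types (p : 'I_N * literal n) (c : seq ('I_N * literal n)).
Implicit Types (l : literal N).

Local Notation F := (flatten S).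
Local Notation widen := (widen_literal le_nN).
Local Notation link := (link_clause le_nN).
Local Notation output := (split_list le_nN S [::]).

Hypothesis uniq_fresh : uniq (map fst F).
Hypothesis fresh_ge : forall p, p \in F -> n <= p.1.
Hypothesis size_block : forall c, c \in S -> (size c == 2) || (size c == 3).

Let source := Instance [set:: [seq [set:: k] | k <- map (map snd) S]].
Let target := Instance [set:: [seq [set:: k] | k <- output]].

Lemma negK : involutive (@neg N).
Proof. by case=> y b; rewrite /neg negbK. Qed.

Lemma mem_blocks c p : c \in S -> p \in c -> p \in F.
Proof. by move=> Sc cp; apply/flattenP; exists c. Qed.

Lemma fresh_inj : {in F &, injective fst}.
Proof.
elim: F uniq_fresh => //= p s IHs /andP[p_s uniq_s] q r.
rewrite !inE => /orP[/eqP-> | sq] /orP[/eqP-> | sr] // eq_qr.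
- by case/negP: p_s; rewrite eq_qr map_f.
- by case/negP: p_s; rewrite -eq_qr map_f.
- exact: IHs.
Qed.

Lemma uniq_block c : c \in S -> uniq (map fst c).
Proof.
elim: S uniq_fresh => //= c' S' IHS; rewrite map_cat cat_uniq.
by case/and3P=> uniq_c' _ uniq_S'; rewrite inE => /orP[/eqP-> // | /IHS->].
Qed.

(** By [uniq_fresh], different blocks have disjoint sets of fresh variables. This serves both to
    show that positive fresh literals are minor and to tell fresh clauses apart. *)
Lemma block_inj c c' p p' :
  c \in S -> c' \in S -> p \in c -> p' \in c' -> p.1 = p'.1 -> c = c'.
Proof.
elim: S uniq_fresh => //= c0 S' IHS; rewrite map_cat cat_uniq.
case/and3P=> _ /hasPn disj uniq_S' Sc Sc' cp cp' eq_p.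
have not_both a b : a \in c0 -> b \in flatten S' -> a.1 <> b.1.
  by move=> c0a Sb eq_ab; have /negP[] := disj _ (map_f fst Sb); rewrite -eq_ab map_f.
move: Sc Sc'; rewrite !inE.
case/orP=> [/eqP eq_c | Sc] /orP[/eqP eq_c' | Sc'].
- by rewrite eq_c eq_c'.
- case: (not_both p p') => //; first by rewrite -eq_c.
  by apply/flattenP; exists c'.
- case: (not_both p' p) => //; first by rewrite -eq_c'.
  by apply/flattenP; exists c.
- exact: IHS.
Qed.

(** Frees the rest of the argument from the order in which clauses are produced; the proof compares
    multiplicities. *)
Lemma perm_split_list T o :
  perm_eq (split_list le_nN T o)
    (map link (flatten T) ++ map (fun c => catrev (fresh_clause c) [::]) T ++ o).
Proof.
elim: T o => //= c T IHT o; apply: perm_trans (IHT _) _.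
apply/permP => a; rewrite /= map_cat !count_cat /=.
rewrite [catrev _ o]catrevE count_cat count_rev.
rewrite -addnA [RHS]addnCA; congr (_ + _).
rewrite addnCA [RHS]addnCA; congr (_ + _).
by rewrite count_cat addnCA.
Qed.

Lemma mem_catrev_fresh c :
  [set:: catrev (fresh_clause c) [::]] = [set:: fresh_clause c].
Proof. by apply/setP=> l; rewrite !inE catrevE cats0 mem_rev. Qed.

Lemma perm_target :
  perm_eq [seq [set:: k] | k <- output]
    ([seq [set:: link p] | p <- F] ++ [seq [set:: fresh_clause c] | c <- S]).
Proof.
have := perm_map (fun k : seq (literal N) => [set:: k]) (perm_split_list S [::]).
rewrite cats0 map_cat -!map_comp => /perm_trans; apply.
rewrite (eq_map (g := fun c => [set:: fresh_clause c])) // => c.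
exact: mem_catrev_fresh.
Qed.

Variant target_clause : {set literal N} -> Prop :=
  | TargetLink p of p \in F : target_clause [set:: link p]
  | TargetFresh c of c \in S : target_clause [set:: fresh_clause c].

Lemma target_clauseP X : reflect (target_clause X) (X \in clauses target).
Proof.
rewrite inE (perm_mem perm_target) mem_cat.
apply: (iffP orP) => [[] /mapP[a Sa ->] | [p Fp | c Sc]].
- exact: TargetLink.
- exact: TargetFresh.
- by left; apply: map_f (fun p => [set:: link p]) _ _ Fp.
- by right; apply: map_f (fun c => [set:: fresh_clause c]) _ _ Sc.
Qed.

Lemma mem_link p l : (l \in [set:: link p]) = (l == (p.1, false)) || (l == widen p.2).
Proof. by rewrite !inE. Qed.

Lemma mem_fresh_clause c l :
  reflect (exists2 p, p \in c & l = (p.1, true)) (l \in [set:: fresh_clause c]).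
Proof. by rewrite inE; apply: mapP. Qed.

Lemma widen_lt (k : literal n) : (widen k).1 < n.
Proof. exact: (ltn_ord k.1). Qed.

(** The other literal of the link is on an old variable, whose index is below [n]. *)
Lemma link_fresh p (y : 'I_N) b :
  n <= y -> (y, b) \in [set:: link p] -> y = p.1 /\ b = false.
Proof.
rewrite mem_link => ge_y /orP[/eqP[-> ->] // | /eqP eq_y].
by have := widen_lt p.2; rewrite -eq_y ltnNge ge_y.
Qed.

(** A negative fresh literal lies only in its own link and a positive one only in the clause of its
    block; the mixed cases fail by polarity. *)
Lemma fresh_minor (y : 'I_N) b : n <= y -> ~~ major (clauses target) (y, b).
Proof.
move=> ge_y; rewrite /major -leqNgt; apply/card_le1_eqP => X X'.
move=> /setIdP[/target_clauseP CX yX] /setIdP[/target_clauseP CX' yX'].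
move: CX CX' yX yX' => [p Fp | c Sc] [p' Fp' | c' Sc'].
- case/(link_fresh ge_y)=> eq_y _ /(link_fresh ge_y)[eq_y' _].
  by rewrite (fresh_inj Fp Fp') // -eq_y -eq_y'.
- by case/(link_fresh ge_y)=> _ -> /mem_fresh_clause[].
- by case/mem_fresh_clause=> p _ [_ ->] /(link_fresh ge_y)[].
- case/mem_fresh_clause=> p cp [eq_y _] /mem_fresh_clause[p' cp' [eq_y' _]].
  by rewrite (block_inj Sc Sc' cp cp') // -eq_y.
Qed.

Lemma uniq_target : uniq [seq [set:: k] | k <- output].
Proof.
rewrite (perm_uniq perm_target) cat_uniq; apply/and3P; split.
(* A link is recognised by its negative fresh literal, which fresh clauses, being positive, do not
   contain. *)
- rewrite map_inj_in_uniq ?(map_uniq uniq_fresh) // => p p' Fp Fp' eq_pp'.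
  apply: fresh_inj => //.
  have : (p.1, false) \in [set:: link p'] by rewrite -eq_pp' mem_link eqxx.
  by case/link_fresh; first exact: fresh_ge.
- apply/hasPn=> _ /mapP[c Sc ->]; apply/negP => /mapP[p Fp eq_cp].
  have : (p.1, false) \in [set:: fresh_clause c] by rewrite eq_cp mem_link eqxx.
  by case/mem_fresh_clause.
- rewrite map_inj_in_uniq => [|c c' Sc Sc' eq_cc'].
    (* A repeated block would repeat its first fresh variable, which exists because blocks have size
       2 or 3. *)
    elim: S uniq_fresh size_block => //= c S' IHS.
    rewrite map_cat cat_uniq => /and3P[_ /hasPn disj uniq_S'] sizes.
    rewrite IHS // => [|c' S'c']; last by rewrite sizes // inE S'c' orbT.
    rewrite andbT; apply/negP => S'c.
    have: (size c == 2) || (size c == 3) by rewrite sizes ?mem_head.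
    case: c S'c disj {sizes} => // p c S'c disj _.
    have /disj/negP[] : p.1 \in map fst (flatten S').
      by apply: map_f; apply/flattenP; exists (p :: c); rewrite ?mem_head.
    by rewrite mem_head.
  have := size_block Sc; case: c Sc eq_cc' => // p c Sc eq_cc' _.
  have : (p.1, true) \in [set:: fresh_clause c'].
    by rewrite -eq_cc'; apply/mem_fresh_clause; exists p; rewrite ?mem_head.
  case/mem_fresh_clause=> p' cp' [eq_p].
  by apply: block_inj Sc Sc' (mem_head _ _) cp' eq_p.
Qed.

Lemma uniq_link p : p \in F -> uniq (link p).
Proof.
move=> Fp; rewrite /= inE andbT; apply/eqP => eq_p.
by have := widen_lt p.2; rewrite -eq_p /= ltnNge fresh_ge.
Qed.

Lemma uniq_fresh_clause c : c \in S -> uniq (fresh_clause c).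
Proof.
move=> Sc; rewrite /fresh_clause (map_comp (pair^~ true) fst).
by rewrite map_inj_uniq ?uniq_block // => y y' [].
Qed.

Lemma uniq_output : all uniq output.
Proof.
rewrite (perm_all _ (perm_split_list _ _)) cats0 all_cat !all_map.
apply/andP; split; apply/allP; first by move=> p; apply: uniq_link.
by move=> c Sc; rewrite /= catrevE cats0 rev_uniq uniq_fresh_clause.
Qed.

Lemma card_set_seq (T : finType) (s : seq T) : uniq s -> #|[set:: s]| = size s.
Proof. by move=> uniq_s; rewrite cardsE; apply/card_uniqP. Qed.

Lemma target_23SAT : is_23SAT target.
Proof.
move=> X /target_clauseP[p Fp | c Sc].
  have ge_p := fresh_ge Fp; split.
  - apply/forallP => -[y b]; apply/negP => /andP[].
    (* If both literals are the same member of the link, the signs clash; otherwise a fresh variable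
       would equal an old one. *)
    rewrite /neg !mem_link /= => /orP[]/eqP eq1 /orP[]/eqP eq2.
    + by move: eq2; case: eq1 => -> -> [].
    + have := widen_lt p.2; rewrite -eq2 /=; case: eq1 => -> _.
      by rewrite ltnNge ge_p.
    + have := widen_lt p.2; rewrite -eq1 /=; case: eq2 => -> _.
      by rewrite ltnNge ge_p.
    + by move: eq2; rewrite -eq1 => -[]; case: (b).
  - by rewrite card_set_seq ?uniq_link.
  - apply: leq_trans (subset_leq_card (_ : _ \subset [set widen p.2])) _.
      apply/subsetP => l /setIdP[]; rewrite mem_link => /orP[]/eqP-> major_l.
        by have := fresh_minor false ge_p; rewrite major_l.
      by rewrite inE.
    by rewrite cards1.
split.
- apply/forallP => l; apply/negP => /andP[/mem_fresh_clause[p _ ->]].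
  by case/mem_fresh_clause.
- by rewrite card_set_seq ?uniq_fresh_clause // size_map size_block.
- rewrite leqW // leqn0 cards_eq0; apply/eqP/setP => l; rewrite [RHS]inE.
  apply/negP => /setIdP[/mem_fresh_clause[p cp ->]]; apply/negP/fresh_minor.
  exact/fresh_ge/mem_blocks/cp.
Qed.

Lemma target_no_bad_pair : ~ (exists B, bad_pair target B).
Proof.
case=> B [sBC [c1 [c2 [_ def_B [l1 [l2 [neq_l]]]]]]].
rewrite !subUset !sub1set => /andP[c1l1 c1l2] /andP[c2l1 c2l2].
have /target_clauseP C1 : c1 \in clauses target.
  by apply: (subsetP sBC); rewrite def_B !inE eqxx.
have /target_clauseP C2 : c2 \in clauses target.
  by apply: (subsetP sBC); rewrite def_B !inE eqxx orbT.
move: C1 c1l1 c1l2 C2 c2l1 c2l2 => [p Fp | c Sc].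
- move=> l1p l2p [p' Fp' | c' Sc'].
    (* Distinct members of a link include its negative fresh literal, whose negation lies in no
       link. *)
    have neg_fresh : neg (p.1, false) \in [set:: link p'] -> False.
      by case/(link_fresh (fresh_ge Fp)).
    move: l1p l2p neq_l; rewrite !mem_link.
    case/orP=> /eqP-> /orP[]/eqP->; rewrite ?eqxx // => _.
    + by rewrite -mem_link => /neg_fresh.
    + by move=> _; rewrite -mem_link => /neg_fresh.
  (* Here both literals are negative and fresh, but a link has only one such literal. *)
  case/mem_fresh_clause=> q c'q neg_l1 /mem_fresh_clause[r c'r neg_l2].
  have def_l1 : l1 = (q.1, false) by rewrite -[l1]negK neg_l1.
  have def_l2 : l2 = (r.1, false) by rewrite -[l2]negK neg_l2.
  rewrite def_l1 def_l2 in l1p l2p neq_l.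
  have [eq_q _] := link_fresh (fresh_ge (mem_blocks Sc' c'q)) l1p.
  have [eq_r _] := link_fresh (fresh_ge (mem_blocks Sc' c'r)) l2p.
  by rewrite eq_q eq_r eqxx in neq_l.
- case/mem_fresh_clause=> q cq def_l1 /mem_fresh_clause[r cr def_l2].
  rewrite def_l1 def_l2 in neq_l *; case=> [p Fp | c' Sc'].
    case/(link_fresh (fresh_ge (mem_blocks Sc cq)))=> eq_q _.
    case/(link_fresh (fresh_ge (mem_blocks Sc cr)))=> eq_r _.
    by move: neq_l; rewrite eq_q eq_r eqxx.
  by case/mem_fresh_clause.
Qed.

(** Forwards, a true variable of a fresh clause forces its literal through the link. Backwards, each
    fresh variable copies the truth value of its literal. *)
Lemma target_satisfiable : satisfiable target <-> satisfiable source.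
Proof.
split=> [[v sat_v] | [v sat_v]].
- exists (fun x => v (widen_ord le_nN x)) => X.
  rewrite inE => /mapP[_ /mapP[c Sc ->] ->].
  have [_ /mem_fresh_clause[p cp ->] /= v_p] :=
    sat_v _ (introT (target_clauseP _) (TargetFresh Sc)).
  have Fp := mem_blocks Sc cp.
  have [l] := sat_v _ (introT (target_clauseP _) (TargetLink Fp)).
  rewrite mem_link => /orP[]/eqP->; first by rewrite /= v_p.
  by exists p.2; rewrite ?inE ?map_f.
(* [insub] succeeds exactly on the old variables; for a fresh one, [has] reads the value at its
   unique occurrence. *)
- pose w (y : 'I_N) := if insub (val y) is Some x then v x
                       else has (fun p => (p.1 == y) && (v p.2.1 == p.2.2)) F.
  have w_fresh p : p \in F -> w p.1 = (v p.2.1 == p.2.2).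
    move=> Fp; rewrite /w insubF ?ltnNge ?fresh_ge //.
    apply/hasP/idP => [[q Fq /andP[/eqP eq_q]] | v_p].
      by rewrite (fresh_inj Fq Fp eq_q).
    by exists p; rewrite ?eqxx.
  have w_widen x : w (widen_ord le_nN x) = v x.
    by rewrite /w /= insubT //= => lt_x; congr v; apply: val_inj.
  exists w => X /target_clauseP[p Fp | c Sc].
    have := w_fresh p Fp; case: eqP => [v_p _ | _ w_p].
      by exists (widen p.2); rewrite ?mem_link ?eqxx ?orbT //= w_widen.
    by exists (p.1, false); rewrite ?mem_link ?eqxx.
  have /sat_v[l] : [set:: map snd c] \in clauses source.
    by rewrite inE; apply: (map_f (fun k => [set:: k])); apply: map_f.
  rewrite inE => /mapP[p cp ->] v_p.
  exists (p.1, true); first by apply/mem_fresh_clause; exists p.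
  by rewrite /= w_fresh ?v_p ?eqxx //; apply: mem_blocks cp.
Qed.

End Reduction.

(** * Total running time and the final theorem *)

Lemma size_tree_of_seqs T (enc : T -> tree) (s : seq (seq T)) :
  size s + size (flatten s) < tree_size (tree_of_seq (tree_of_seq enc) s).
Proof.
elim: s => //= c s IHs; rewrite size_cat.
by have := size_tree_of_seq enc c; lia.
Qed.

(** Turns bounds in the numbers of variables, clauses and occurrences into bounds in the input
    size. *)
Lemma tree_of_lists_ge n (s : seq (seq (literal n))) :
  n + size s + size (flatten s) < tree_size (tree_of_lists s).
Proof.
have := size_tree_of_seq tree_of_nat (iota 0 n); rewrite size_iota.
have := size_tree_of_seqs (@tree_of_literal n) s.
rewrite /=; lia.
Qed.

Lemma runs_split_instance n N (le_nN : n <= N) (S : seq (seq ('I_N * literal n))) :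
  let m := size (flatten S) in
  let t := tree_of_lists (map (map snd) S) in
  N = (n + m).+1 ->
  [seq val p.1 | p <- flatten S] = iota n m ->
  exists ts', runs split_instance
    [:: t; Leaf; Leaf; Leaf; Leaf; Leaf; Leaf]
    (tree_of_lists (split_list le_nN S [::]) :: ts')
    (1000 * (64 * tree_size t ^ 3)).
Proof.
(* [B] bounds the register sizes in all loops. It is quadratic because up to [s] occurrences produce
   clauses of size linear in [s]; 64 leaves room for [40 * s ^ 2] from the output clauses. *)
move=> m t def_N fresh_m; set s := tree_size t; set B := 64 * s ^ 2.
have m_E : m = size (flatten (map (map snd) S)) by rewrite -map_flatten size_map.
have lt_s : n + size S + m < s.
  by rewrite m_E -(size_map (map snd) S); exact: tree_of_lists_ge.
have s_E : s = (tree_size (tree_of_seq tree_of_nat (iota 0 n))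
    + tree_size (tree_of_seq (tree_of_seq (@tree_of_literal n)) (map (map snd) S))).+1.
  by [].
have le_sB : s <= B by rewrite /B; nia.
have leN : 4 * (n + m).+2 ^ 2 <= B.
  have le_s : (n + m).+2 <= 2 * s by lia.
  by rewrite /B; nia.
have leN' : 4 * (n + m).+1 ^ 2 <= B.
  by apply: leq_trans leN; rewrite leq_mul2l leq_exp2r // leqnSn.
have leq_out : 1 + m * (4 * literal_bound N) + 2 * size S < B.
  have : literal_bound N <= 10 * s by rewrite /literal_bound; lia.
  have : m < s by lia.
  by move: (literal_bound N) => q lt_ms le_q; rewrite /B; nia.
have szL := tree_size_down_to N.
rewrite def_N in szL.
eexists; apply: runs_le.
  apply: runs_seq; first exact: runs_assign.
  apply: runs_seq; first exact: runs_assign.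
  apply: runs_seq.
    apply: (@runs_number_variables _ tree_of_nat (iota 0 n) _ Leaf Leaf 0 B).
      by rewrite size_iota; nia.
    by lia.
  rewrite size_iota add0n.
  apply: runs_seq.
    apply: (@runs_split_clauses n N le_nN S n [::] B) => //; lia.
  apply: runs_seq; first exact: (@runs_fresh _ _ _ _ _ B).
  apply: runs_seq.
    apply: (@runs_reverse_variables _ tree_of_nat _ [::] _ _ _ _ _ (B + 1)).
    by rewrite -/(down_to _) -/m /=; lia.
  rewrite catrevE cats0 revK -/m -def_N; exact: runs_assign.
rewrite size_rev !size_iota /=.
have := tree_size_split_list le_nN S [::].
have : tree_size (tree_of_seq tree_of_nat (iota 0 N)) <= B.
  have := tree_size_catrev tree_of_nat (iota 0 N) [::].
  by rewrite catrevE cats0 -/(down_to _) def_N /=; lia.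
rewrite -/m /=; move: leq_out s_E lt_s le_sB.
(* The number of rounds of each loop is linear in [s], so with [s * B] as an atom the total becomes
   linear arithmetic. *)
have -> : 64 * s ^ 3 = s * B by rewrite /B expnS mulnCA.
have := leq_mul (_ : n.+1 <= s) (leqnn B).
have := leq_mul (_ : (m + size S).+1 <= s) (leqnn B).
have := leq_mul (_ : (n + m).+2 <= 2 * s) (leqnn B).
have := leq_mul (_ : 1 <= s) (leqnn B).
clearbody m s B => /= h1 h2 h3 h4 leq_out s_E lt_s le_sB.
have {}h1 := h1 ltac:(lia); have {}h2 := h2 ltac:(lia).
have {}h3 := h3 ltac:(lia); have {}h4 := h4 ltac:(lia).
move: (literal_bound N) leq_out => q leq_out.
lia.
Qed.

Theorem theorem4 :
  exists (p : cmd) (P : {poly nat}),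
    forall (I : instance) (t : tree),
      is_23SAT I -> encodes t I ->
      exists (u : tree) (k : nat) (J : instance),
        [/\ run p t u k, k <= P.[tree_size t]%R & encodes u J] /\
        [/\ is_23SAT J,
            ~ (exists B : {set {set literal (nvars J)}}, bad_pair J B)
          & satisfiable J <-> satisfiable I].
Proof.
exists split_instance, ((1000 * 64)%N *: 'X^3)%R.
move=> [n C] t sat23 [s [uniq_s _ /= def_C def_t]].
set m := size (flatten s); set N := (n + m).+1.
have le_nN : n <= N by rewrite /N; lia.
(* The fresh variables are numbered from [n] to [n + m - 1], all below [N], so [inord] never takes
   its default value. *)
pose fresh : seq 'I_N := [seq inord k | k <- iota n m].
(* Occurrences are paired with fresh variables in reading order, then cut back into the original
   clauses. *)
pose S := reshape (shape s) (zip fresh (flatten s)).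
have size_fresh : size fresh = m by rewrite size_map size_iota.
have F_E : flatten S = zip fresh (flatten s).
  by rewrite reshapeKr // size_zip size_fresh minnn -size_flatten.
have fst_F : map fst (flatten S) = fresh
  by rewrite F_E; apply: unzip1_zip; rewrite size_fresh.
have snd_S : map (map snd) S = s.
  by rewrite map_reshape -/unzip2 unzip2_zip ?size_fresh // flattenK.
have size_F : size (flatten S) = m by rewrite -(size_map fst) fst_F.
have val_fresh : map val fresh = iota n m.
  rewrite -map_comp -[RHS]map_id; apply/eq_in_map => k.
  by rewrite mem_iota => /andP[_ lt_k] /=; rewrite inordK // ltnW.
have val_F : [seq val p.1 | p <- flatten S] = iota n m.
  by rewrite (map_comp val fst) fst_F.
have uniq_F : uniq (map fst (flatten S)).
  by rewrite fst_F -(map_inj_uniq val_inj) val_fresh iota_uniq.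
have ge_F p : p \in flatten S -> n <= p.1.
  move=> /(map_f (fun p => val p.1)); rewrite val_F mem_iota.
  by case/andP.
have sizes c : c \in S -> (size c == 2) || (size c == 3).
  move=> Sc; have s_c : map snd c \in s by rewrite -snd_S map_f.
  have [] := sat23 [set:: map snd c].
    by rewrite /= def_C inE map_f.
  (* The encoding lists each clause without repetitions, so the length of the list is the
     cardinality of the clause. *)
  by rewrite card_set_seq ?size_map // (allP uniq_s).
have [||ts' [k exec_k le_k]] := @runs_split_instance n N le_nN S.
- by rewrite size_F.
- by rewrite size_F.
exists (tree_of_lists (split_list le_nN S [::])), k.
exists (Instance [set:: [seq [set:: c] | c <- split_list le_nN S [::]]]).
split; split.
- exists (nth Leaf (tree_of_lists (split_list le_nN S [::]) :: ts')); split=> //.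
  have -> : update (fun=> Leaf) 0 t
          = nth Leaf [:: t; Leaf; Leaf; Leaf; Leaf; Leaf; Leaf].
    apply: functional_extensionality => -[|[|[|[|[|[|[|x]]]]]]] //=.
    by rewrite nth_nil.
  by rewrite snd_S -def_t in exec_k.
- rewrite snd_S -def_t in le_k; apply: leq_trans le_k _.
  by rewrite hornerZ hornerXn natrME natrXE mulnA leqnn.
- exists (split_list le_nN S [::]); split=> //.
    exact: uniq_output.
  exact: uniq_target.
- exact: target_23SAT.
- exact: target_no_bad_pair.
- have := target_satisfiable le_nN uniq_F ge_F.
  by rewrite def_C snd_S.
Qed.
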